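(* Let $n \geq 1$, let $K \subset \mathbb{R}^n$ be a compact convex body with smooth boundary and let $L \subset \mathbb{R}^n$ be a lattice of full rank. Then there exist a set $S \subset L$ with $|S| = n+1$ and a translated copy $K' = K + v$ of $K$ (for some $v \in \mathbb{R}^n$) such that $S$ illuminates $K'$ and $$d(S,K') \leq 2 \left( \frac{4}{3} \right)^{\frac{n(n-1)}{2}} \left[ \left( \frac{4}{3} \right)^{\frac{n(n-1)}{2}} \frac{C_n D(K)}{\|L\|} + 1 \right] \frac{\det(L)}{\|L\|^{n-1}},$$ where $[\ ]$ denotes the integer part and $$C_n = \frac{ n \sqrt{n} \left( n+2^{n-1} \right)}{\sqrt{2(n+1)}}.$$
   Context: $\|\cdot\|$ is the Euclidean norm on $\mathbb{R}^n$. A compact convex body is a compact convex subset of $\mathbb{R}^n$ with nonempty interior; $\partial K$ is its boundary and $\mathrm{int}(K)$ its interior. $K$ has smooth boundary if there is a unique support hyperplane to $K$ at each point of $\partial K$. A point $x \in \mathbb{R}^n$ illuminates a point $y \in \partial K$ (with $x \neq y$) if the line segment connecting $x$ and $y$ does not intersect $\mathrm{int}(K)$, but the line containing this segment intersects $\mathrm{int}(K)$. A set $S \subset \mathbb{R}^n$ illuminates $K$ if every $y \in \partial K$ is illuminated by some $x \in S$. For a finite set $S$ that illuminates $K$, the illumination distance is $d(S,K) = \max\{\|x-y\| : x \in S,\ y \in K\}$. The diameter of $K$ is $D(K) = \max\{\|x-y\| : x,y \in K\}$ (invariant under translation). Convention of the source: translated copies of $K$ are identified with $K$, so illuminating $K$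 means illuminating some translated copy of $K$; this is written out explicitly in the claim. For a full-rank lattice $L \subset \mathbb{R}^n$, $\det(L)$ is its determinant (the absolute value of the determinant of a basis matrix) and $\|L\| = \min\{\|x\| : x \in L\setminus\{0\}\}$ is its minimal norm. *)

(* Defs.v *)
From HB Require Import structures.
From mathcomp Require Import all_boot all_order all_algebra.
From mathcomp Require Import all_classical all_reals all_analysis.

Set Implicit Arguments.
Unset Strict Implicit.
Unset Printing Implicit Defensive.

Import Order.TTheory GRing.Theory Num.Theory.
Import numFieldNormedType.Exports.

Local Open Scope classical_set_scope.
Local Open Scope ring_scope.

(* Row vectors 'rV[R]_n model R^n. The library's norm `|x| on them is the
   sup norm, so the Euclidean norm is defined here. The two induce the same
   topology, so the library's compact and interior (K°) are the usual ones. *)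
Definition dotv (R : realType) (n : nat) (u v : 'rV[R]_n) : R :=
  \sum_(i < n) u 0 i * v 0 i.

Definition enorm (R : realType) (n : nat) (u : 'rV[R]_n) : R :=
  Num.sqrt (dotv u u).

Definition boundary (R : realType) (n : nat) (K : set 'rV[R]_n) :
  set 'rV[R]_n := closure K `\` K°.

Definition convex_body (R : realType) (n : nat) (K : set 'rV[R]_n) : Prop :=
  [/\ compact K, convex_set (K : set (convex_lmodType 'rV[R]_n)) & K° !=set0].

Definition hyperplane (R : realType) (n : nat) (a : 'rV[R]_n) (b : R) :
  set 'rV[R]_n := [set x | dotv a x = b].

(* Replacing (a, b) by (- a, - b) leaves the hyperplane unchanged, so
   requiring K to lie on the side <a, x> <= b loses no generality. *)
Definition support_hyperplane (R : realType) (n : nat) (K : set 'rV[R]_n)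
    (y : 'rV[R]_n) (H : set 'rV[R]_n) : Prop :=
  exists (a : 'rV[R]_n) (b : R),
    [/\ a != 0, H = hyperplane a b, H y & forall x, K x -> dotv a x <= b].

Definition smooth_boundary (R : realType) (n : nat) (K : set 'rV[R]_n) : Prop :=
  forall y, boundary K y -> exists! H, support_hyperplane K y H.

Definition line (R : realType) (n : nat) (x y : 'rV[R]_n) : set 'rV[R]_n :=
  [set (1 - t) *: x + t *: y | t in [set: R]].

Definition segment (R : realType) (n : nat) (x y : 'rV[R]_n) : set 'rV[R]_n :=
  [set (1 - t) *: x + t *: y | t in [set t : R | 0 <= t <= 1]].

Definition illuminates_point (R : realType) (n : nat) (K : set 'rV[R]_n)
    (x y : 'rV[R]_n) : Prop :=
  [/\ x != y, segment x y `&` K° = set0 & line x y `&` K° !=set0].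

Definition illuminates (R : realType) (n : nat) (S K : set 'rV[R]_n) : Prop :=
  forall y, boundary K y -> exists2 x, S x & illuminates_point K x y.

Definition translate (R : realType) (n : nat) (K : set 'rV[R]_n)
    (v : 'rV[R]_n) : set 'rV[R]_n := [set x + v | x in K].

(* For S finite and K compact, both nonempty, this supremum is a maximum
   (max_distanceP below). *)
Definition max_distance (R : realType) (n : nat) (S K : set 'rV[R]_n) : R :=
  sup [set enorm (p.1 - p.2) | p in S `*` K].

Definition illumination_distance (R : realType) (n : nat)
  (S K : set 'rV[R]_n) : R := max_distance S K.

Definition diameter (R : realType) (n : nat) (K : set 'rV[R]_n) : R :=
  max_distance K K.

(* The rows of B form a basis of the full-rank lattice L. *)
Definition lattice_basis (R : realType) (n : nat) (L : set 'rV[R]_n)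
    (B : 'M[R]_n) : Prop :=
  B \in unitmx /\ L = [set map_mx intr z *m B | z in [set: 'rV[int]_n]].

Definition full_rank_lattice (R : realType) (n : nat) (L : set 'rV[R]_n) :
  Prop := exists B : 'M[R]_n, lattice_basis L B.

(* Independent of the chosen basis (lattice_detE below). *)
Definition lattice_det (R : realType) (n : nat) (L : set 'rV[R]_n) : R :=
  `|\det (xget 1%:M [set B | lattice_basis L B])|.

(* For L a full-rank lattice and 0 < n, this infimum is a minimum
   (lattice_min_normP below). *)
Definition lattice_min_norm (R : realType) (n : nat) (L : set 'rV[R]_n) : R :=
  inf [set enorm x | x in L `\ 0].

Definition C_ (R : realType) (n : nat) : R :=
  n%:R * Num.sqrt n%:R * (n%:R + 2 ^+ (n - 1)) / Num.sqrt (2 * n.+1%:R).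

Lemma enorm_continuous (R : realType) (n : nat) : continuous (@enorm R n).
Proof.
have dc : continuous (fun x : 'rV[R]_n => dotv x x).
  rewrite /dotv; apply: continuous_big => [|i _]; first exact: add_continuous.
  move=> x; pose c (y : 'rV[R]_n) := y 0 i.
  by apply: (@continuousM R _ c c); exact: coord_continuous.
move=> x; apply: (@continuous_comp _ _ _ (fun x : 'rV[R]_n => dotv x x)).
  exact: dc.
exact: sqrt_continuous.
Qed.

Lemma max_distanceP (R : realType) (n : nat) (S K : set 'rV[R]_n) :
  S !=set0 -> compact S -> K !=set0 -> compact K ->
  (exists x y, [/\ S x, K y & max_distance S K = enorm (x - y)]) /\
  (forall x y, S x -> K y -> enorm (x - y) <= max_distance S K).
Proof.
move=> [s Ss] cS [k Kk] cK.
have cont : continuous (fun p : 'rV[R]_n * 'rV[R]_n => enorm (p.1 - p.2)).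
  move=> p; apply: (@continuous_comp _ _ _
    (fun p : 'rV[R]_n * 'rV[R]_n => p.1 - p.2)); last exact: enorm_continuous.
  by apply: cvgB; [exact: cvg_fst|exact: cvg_snd].
have SK0 : S `*` K !=set0 by exists (s, k).
have [[x y]] := compact_EVT_max SK0 (compact_setX cS cK)
  (continuous_subspaceT cont).
rewrite inE => -[/= Sx Ky] maxxy.
have ubxy : ubound [set enorm (p.1 - p.2) | p in S `*` K] (enorm (x - y)).
  by move=> _ [p SKp <-]; apply: maxxy; rewrite inE.
have le x' y' : S x' -> K y' -> enorm (x' - y') <= max_distance S K.
  move=> Sx' Ky'; apply: ub_le_sup; first by exists (enorm (x - y)).
  by exists (x', y').
split=> //; exists x, y; split=> //; apply/eqP; rewrite eq_le le// andbT.
by apply: ge_sup => //; exists (enorm (x - y)), (x, y).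
Qed.

Lemma lattice_basis_change (R : realType) (n : nat) (L : set 'rV[R]_n)
    (B B' : 'M[R]_n) :
  lattice_basis L B -> lattice_basis L B' ->
  exists Z : 'M[int]_n, B' = map_mx intr Z *m B.
Proof.
move=> [_ LB] [_ LB'].
have rowP i : exists z : 'rV[int]_n, map_mx intr z *m B = row i B'.
  have : L (row i B').
    rewrite LB'; exists (delta_mx 0 i) => //.
    by rewrite map_delta_mx rowE.
  by rewrite LB => -[z _ <-]; exists z.
have [f fP] := choice rowP; exists (\matrix_i f i).
apply/row_matrixP => i; rewrite row_mul -fP; congr (_ *m _).
by rewrite -map_row rowK.
Qed.

Lemma lattice_detE (R : realType) (n : nat) (L : set 'rV[R]_n) (B : 'M[R]_n) :
  lattice_basis L B -> lattice_det L = `|\det B|.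
Proof.
move=> LB; rewrite /lattice_det.
have : lattice_basis L (xget 1%:M [set B | lattice_basis L B]).
  by apply: (@xgetPex _ 1%:M [set B | lattice_basis L B]); exists B.
move: (xget _ _) => B' LB'.
have le (A A' : 'M[R]_n) : lattice_basis L A -> lattice_basis L A' ->
    `|\det A| <= `|\det A'|.
  move=> LA LA'; have [Z A'E] := lattice_basis_change LA LA'.
  have A'0 : \det A' != 0 by rewrite -unitfE -unitmxE; case: LA'.
  move: A'0; rewrite A'E det_mulmx det_map_mx mulf_eq0 negb_or => /andP[Z0 _].
  rewrite normrM ler_peMl// -intr_norm ler1z -gtz0_ge1 normr_gt0.
  by move: Z0; rewrite intr_eq0.
by apply/eqP; rewrite eq_le !le.
Qed.

Lemma coord_le_enorm (R : realType) (n : nat) (x : 'rV[R]_n) (i : 'I_n) :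
  `|x 0 i| <= enorm x.
Proof.
rewrite -sqrtr_sqr ler_sqrt; last by apply: sumr_ge0 => j _; exact: sqr_ge0.
rewrite /dotv (bigD1 i)//= expr2 lerDl.
by apply: sumr_ge0 => j _; exact: sqr_ge0.
Qed.

Lemma lattice_min_normP (R : realType) (n : nat) (L : set 'rV[R]_n) :
  (0 < n)%N -> full_rank_lattice L ->
  (exists x, [/\ L x, x != 0 & lattice_min_norm L = enorm x]) /\
  (forall x, L x -> x != 0 -> lattice_min_norm L <= enorm x).
Proof.
move=> n0 [B [Bu LE]].
have lb x : L x -> x != 0 -> lattice_min_norm L <= enorm x.
  move=> Lx x0; apply: ge_inf.
    by exists 0 => _ [y _ <-]; exact: sqrtr_ge0.
  by exists x => //; split=> //; exact/eqP.
split=> //.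
pose i0 := Ordinal n0; pose x0 := row i0 B.
pose M := enorm x0 * \sum_j \sum_i `|invmx B j i|.
pose N := Num.bound M.
pose dec (f : 'rV['I_(N + N).+1]_n) : 'rV[int]_n :=
  map_mx (fun k : 'I_(N + N).+1 => (k : nat)%:Z - N%:Z) f.
pose pt (f : 'rV['I_(N + N).+1]_n) : 'rV[R]_n := map_mx intr (dec f) *m B.
have Lpt f : L (pt f) by rewrite LE; exists (dec f).
have small x : L x -> enorm x <= enorm x0 -> exists f, x = pt f.
  rewrite {1}LE => -[z _ zx] xx0.
  have zE : map_mx intr z = x *m invmx B by rewrite -zx mulmxK.
  have zN i : `|z 0 i| <= N%:Z.
    rewrite -(ler_int R) intr_norm.
    have -> : (z 0 i)%:~R = (map_mx intr z : 'rV[R]_n) 0 i by rewrite mxE.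
    rewrite zE mxE; apply: le_trans (ler_norm_sum _ _ _) _.
    have MN : M <= N%:R.
      apply/ltW/archi_boundP/mulr_ge0; first exact: sqrtr_ge0.
      by apply: sumr_ge0 => ? _; exact: sumr_ge0.
    apply: le_trans MN; rewrite /M mulr_sumr; apply: ler_sum => j _.
    rewrite normrM ler_pM// ?(le_trans (coord_le_enorm x j))//.
    by rewrite (bigD1 i)//= lerDl sumr_ge0.
  exists (\row_i inord `|(z 0 i + N%:Z)%R|%N).
  rewrite -zx /pt; congr (map_mx _ _ *m _); apply/rowP => i; rewrite !mxE.
  have := zN i; rewrite ler_norml => /andP[zl zr].
  have z0 : 0 <= z 0 i + N%:Z by rewrite -lerBlDr sub0r.
  rewrite inordK; first by rewrite gez0_abs// addrK.
  by rewrite ltnS -lez_nat gez0_abs// PoszD lerD2r.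
have x0L : L x0.
  by rewrite LE; exists (delta_mx 0 i0) => //; rewrite map_delta_mx -rowE.
have x0N0 : x0 != 0.
  apply/eqP => x00; have : x0 *m invmx B = 0 by rewrite x00 mul0mx.
  rewrite /x0 rowE mulmxK// => /matrixP/(_ 0 i0)/eqP.
  by rewrite !mxE !eqxx oner_eq0.
have [f0 f0E] := small _ x0L (lexx _).
have ptf0 : pt f0 != 0 by rewrite -f0E.
have [/= f fN0 fmin] :=
  Order.TotalTheory.arg_minP (P := fun f => pt f != 0) (fun f => enorm (pt f)) ptf0.
exists (pt f); split=> //; apply/eqP; rewrite eq_le lb//=.
apply: lb_le_inf; first by exists (enorm (pt f)), (pt f) => //; split=> //; exact/eqP.
move=> _ [x [Lx /eqP xN0] <-].
have [xx0|/ltW xx0] := leP (enorm x) (enorm x0).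
  by have [g xg] := small _ Lx xx0; rewrite xg; apply: fmin; rewrite -xg.
by apply: le_trans xx0; rewrite f0E; exact: fmin.
Qed.

(* Main.v *)
Require Import Defs.
From mathcomp Require Import all_boot all_order all_algebra.
From mathcomp Require Import all_classical all_reals all_analysis.
From mathcomp Require Import ring lra.
Import Order.TTheory GRing.Theory Num.Theory.
Import numFieldNormedType.Exports.
Local Open Scope classical_set_scope.
Local Open Scope ring_scope.

(* Hermite reduction provides a basis b_1, ..., b_n of L whose norms have product
   at most (4/3)^(n(n-1)/2) det L; hence each |b_i| is at most
   (4/3)^(n(n-1)/2) det L / ||L||^(n-1). By Cramer's rule and Hadamard's
   inequality, the i-th coordinate functional in this basis has norm at most
   (4/3)^(n(n-1)/2) / ||L||, so some translate of K lies in the interior of the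
   simplex with vertices 0, t b_1, ..., t b_n as soon as t exceeds
   n (4/3)^(n(n-1)/2) D(K) / ||L||; since n <= C_n, the integer part of the
   theorem is such a t. If a is the outer normal of the translate at a
   boundary point y, some vertex x of the simplex satisfies <a, x> > <a, y>,
   and by smoothness this is enough for x to illuminate y. *)

(** * Euclidean norm and Gram determinants *)

Section EuclideanNorm.
Context {R : realType} {n : nat}.
Implicit Types (u v w : 'rV[R]_n) (c : R).

Lemma dotvC u v : dotv u v = dotv v u.
Proof. by apply: eq_bigr => i _; rewrite mulrC. Qed.

Lemma dotvDl u v w : dotv (u + v) w = dotv u w + dotv v w.
Proof. by rewrite -big_split; apply: eq_bigr => i _; rewrite mxE mulrDl. Qed.

Lemma dotvZl c u v : dotv (c *: u) v = c * dotv u v.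
Proof. by rewrite mulr_sumr; apply: eq_bigr => i _; rewrite mxE mulrA. Qed.

Lemma dotvDr u v w : dotv w (u + v) = dotv w u + dotv w v.
Proof. by rewrite !(dotvC w) dotvDl. Qed.

Lemma dotvZr c u v : dotv u (c *: v) = c * dotv u v.
Proof. by rewrite !(dotvC u) dotvZl. Qed.

Lemma dotvNl u v : dotv (- u) v = - dotv u v.
Proof. by rewrite -scaleN1r dotvZl mulN1r. Qed.

Lemma dotvNr u v : dotv u (- v) = - dotv u v.
Proof. by rewrite !(dotvC u) dotvNl. Qed.

Lemma dotv0 u : dotv u 0 = 0.
Proof. by rewrite -(scale0r 0) dotvZr mul0r. Qed.

Definition dotvE := (dotvDl, dotvDr, dotvNl, dotvNr, dotvZl, dotvZr).

Lemma dotv_ge0 u : 0 <= dotv u u.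
Proof. by apply: sumr_ge0 => i _; rewrite -expr2 sqr_ge0. Qed.

Lemma dotv_eq0 u : (dotv u u == 0) = (u == 0).
Proof.
rewrite psumr_eq0 => [|i _]; last by rewrite -expr2 sqr_ge0.
apply/allP/eqP => [u0|-> i _]; last by rewrite /= mxE mul0r eqxx.
apply/rowP => i; apply/eqP; have := u0 i (mem_index_enum i).
by rewrite /= mulf_eq0 orbb mxE.
Qed.

Lemma dotv_gt0 u : (0 < dotv u u) = (u != 0).
Proof. by rewrite lt0r dotv_eq0 dotv_ge0 andbT. Qed.

Lemma dotv_mx u v : dotv u v = (u *m v^T) 0 0.
Proof. by rewrite mxE; apply: eq_bigr => i _; rewrite mxE. Qed.

Lemma sqr_enorm u : enorm u ^+ 2 = dotv u u.
Proof. by rewrite sqr_sqrtr// dotv_ge0. Qed.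

Lemma enorm_ge0 u : 0 <= enorm u.
Proof. exact: sqrtr_ge0. Qed.

Lemma enorm_gt0 u : (0 < enorm u) = (u != 0).
Proof. by rewrite sqrtr_gt0 dotv_gt0. Qed.

Lemma enormZ c u : enorm (c *: u) = `|c| * enorm u.
Proof. by rewrite /enorm !dotvE mulrA -expr2 sqrtrM ?sqr_ge0// sqrtr_sqr. Qed.

Lemma enormN u : enorm (- u) = enorm u.
Proof. by rewrite /enorm !dotvE opprK. Qed.

Lemma cauchy_schwarz u v : dotv u v <= enorm u * enorm v.
Proof.
have [->|v0] := eqVneq v 0; first by rewrite dotv0 mulr_ge0 ?enorm_ge0.
have vv0 : 0 < dotv v v by rewrite dotv_gt0.
have sq : dotv u v ^+ 2 <= (enorm u * enorm v) ^+ 2.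
  rewrite exprMn !sqr_enorm -(ler_pM2l vv0) -subr_ge0.
  suff -> : dotv v v * (dotv u u * dotv v v) - dotv v v * dotv u v ^+ 2 =
      dotv (dotv v v *: u - dotv u v *: v) (dotv v v *: u - dotv u v *: v).
    exact: dotv_ge0.
  by rewrite !dotvE (dotvC v u); ring.
apply: le_trans (ler_norm _) _.
by rewrite -ler_sqr ?nnegrE ?mulr_ge0 ?enorm_ge0// real_normK// num_real.
Qed.

Lemma ler_enormD u v : enorm (u + v) <= enorm u + enorm v.
Proof.
rewrite -ler_sqr ?nnegrE ?addr_ge0 ?enorm_ge0// sqr_enorm !dotvE (dotvC v u).
rewrite sqrrD !sqr_enorm; have := cauchy_schwarz u v; lra.
Qed.

Lemma ler_enorm_sum (I : Type) (r : seq I) (P : pred I) (F : I -> 'rV[R]_n) :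
  enorm (\sum_(i <- r | P i) F i) <= \sum_(i <- r | P i) enorm (F i).
Proof.
elim/big_ind2: _ => [|x a y b xa yb|//]; first by rewrite /enorm dotv0 sqrtr0.
exact: le_trans (ler_enormD _ _) (lerD xa yb).
Qed.

Lemma continuous_dotv u : continuous (dotv u).
Proof.
rewrite /dotv; apply: continuous_big => [|i _]; first exact: add_continuous.
move=> x; pose c (y : 'rV[R]_n) := y 0 i.
apply: (@continuousM R _ (fun=> u 0 i) c); first exact: cst_continuous.
exact: coord_continuous.
Qed.

End EuclideanNorm.

Section GramDeterminant.
Context {R : realType}.

Definition gram {m n} (B : 'M[R]_(m, n)) : 'M[R]_m := B *m B^T.

(** Adding multiples of [b] to the rows of [C] is left multiplication by the unipotent matrix [U],
    which preserves the Gram determinant; by orthogonality the Gram matrix of [col_mx b C] is block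
    diagonal. *)
Lemma det_gram_col_mx {m n} (b : 'rV[R]_n) (C : 'M[R]_(m, n)) (mu : 'cV[R]_m) :
  C *m b^T = 0 ->
  \det (gram (col_mx b (C + mu *m b))) = dotv b b * \det (gram C).
Proof.
move=> Cb; have bC : b *m C^T = 0 by apply: trmx_inj; rewrite trmx_mul trmxK Cb trmx0.
pose U := block_mx 1%:M 0 mu 1%:M : 'M[R]_(1 + m).
have -> : col_mx b (C + mu *m b) = U *m col_mx b C.
  by rewrite /U mul_block_col !mul1mx mul0mx addr0 addrC.
have detU : \det U = 1 by rewrite det_lblock !det1 mulr1.
rewrite /gram trmx_mul mulmxA -(mulmxA U) !det_mulmx det_tr detU mulr1 mul1r.
rewrite tr_col_mx mul_col_row Cb bC det_ublock; congr (_ * _).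
by rewrite [b *m _]mx11_scalar det_scalar1 dotv_mx.
Qed.

(** One step of Gram-Schmidt: the rows of [C] are the remaining rows of [B] projected orthogonally
    to the first row [b]. *)
Lemma gram_schmidt_step {m n} (B : 'M[R]_(1 + m, n)) :
  let b := usubmx B in let mu := (dotv b b)^-1 *: (dsubmx B *m b^T) in
  let C := dsubmx B - mu *m b in
  b != 0 -> [/\ B = col_mx b (C + mu *m b), C *m b^T = 0 &
    \det (gram B) = dotv b b * \det (gram C)].
Proof.
move=> b mu C b0.
have BE : B = col_mx b (C + mu *m b) by rewrite subrK vsubmxK.
have Cb : C *m b^T = 0.
  rewrite mulmxBl -mulmxA [b *m _]mx11_scalar -dotv_mx mul_mx_scalar.
  by rewrite scalerA mulfV ?scale1r ?subrr// dotv_eq0.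
by split=> //; rewrite {1}BE det_gram_col_mx.
Qed.

Lemma dotv_row_orthogonalD {m n} (b : 'rV[R]_n) (C : 'M[R]_(m, n))
    (mu : 'cV[R]_m) (i : 'I_m) : C *m b^T = 0 ->
  dotv (row i (C + mu *m b)) (row i (C + mu *m b)) =
  dotv (row i C) (row i C) + mu i 0 ^+ 2 * dotv b b.
Proof.
move=> Cb; have -> : row i (C + mu *m b) = row i C + mu i 0 *: b.
  by apply/rowP => j; rewrite !mxE big_ord1.
have rb : dotv (row i C) b = 0 by rewrite dotv_mx -row_mul Cb !mxE.
by rewrite !dotvE (dotvC b) rb; ring.
Qed.

(** Induction on the number of rows: splitting off the first row leaves the Gram determinant of the
    projected rows, and by Pythagoras projection lengthens no row. *)
Lemma hadamard_gram {m n} (B : 'M[R]_(m, n)) :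
  0 <= \det (gram B) <= \prod_i dotv (row i B) (row i B).
Proof.
elim: m B => [|m IH] B; first by rewrite big_ord0 det_mx00 lexx ler01.
rewrite -[m.+1]/(1 + m)%N in B *.
have r0 : row 0 B = usubmx B.
  by apply/rowP => j; rewrite !mxE; congr (B _ _); apply/val_inj.
have [b0|b0] := eqVneq (usubmx B) 0.
  have -> : \det (gram B) = 0.
    apply/eqP; rewrite -[_ == 0]negbK -unitfE -unitmxE; apply/negP => U.
    have /(congr1 (mulmx^~ (invmx (gram B)))) : row 0 (gram B) = 0.
      by rewrite row_mul r0 b0 mul0mx.
    rewrite -row_mul mulmxV// mul0mx => /rowP/(_ 0)/eqP.
    by rewrite !mxE eqxx oner_eq0.
  by rewrite lexx prodr_ge0// => i _; exact: dotv_ge0.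
have [BE Cb ->] := gram_schmidt_step B b0.
set mu := _ *: (_ *m _) in BE Cb *; set C := _ - _ in BE Cb *.
have /andP[C0 CI] := IH C.
rewrite mulr_ge0 ?dotv_ge0//= big_ord_recl.
have -> : row ord0 B = usubmx B by rewrite -r0; congr row; exact/val_inj.
apply: ler_wpM2l; first exact: dotv_ge0.
apply: (le_trans CI); apply: ler_prod => i _; rewrite dotv_ge0/=.
have -> : row (lift ord0 i) B = row i (C + mu *m usubmx B).
  rewrite -(rowKd i (usubmx B)) -BE; congr row; exact/val_inj.
by rewrite dotv_row_orthogonalD// lerDl mulr_ge0 ?sqr_ge0 ?dotv_ge0.
Qed.

Lemma hadamard {n} (A : 'M[R]_n) : `|\det A| <= \prod_i enorm (row i A).
Proof.
rewrite -ler_sqr ?nnegrE ?prodr_ge0// => [|i _]; last exact: enorm_ge0.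
rewrite real_normK ?num_real// -prodrXl.
under eq_bigr do rewrite sqr_enorm.
have /andP[_] := hadamard_gram A.
by rewrite /gram det_mulmx det_tr expr2.
Qed.

End GramDeterminant.

(** * Hermite reduction *)

Section ReducedBasis.
Context {R : realType}.

(* Coordinates of short lattice vectors are bounded, because z is recovered
   from z *m B by the matrix B^T *m invmx (gram B). *)
Lemma gram_shortest {m n} (B : 'M[R]_(m.+1, n)) : \det (gram B) != 0 ->
  exists2 z : 'rV[int]_m.+1, z != 0 & forall z' : 'rV[int]_m.+1, z' != 0 ->
    dotv (map_mx intr z *m B) (map_mx intr z *m B) <=
    dotv (map_mx intr z' *m B) (map_mx intr z' *m B).
Proof.
move=> dB; pose pt (z : 'rV[int]_m.+1) := map_mx intr z *m B.
suff : exists2 z : 'rV[int]_m.+1, z != 0 & forall z', z' != 0 ->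
    enorm (pt z) <= enorm (pt z').
  move=> [z z0 zm]; exists z => // z' /zm.
  by rewrite -ler_sqr ?nnegrE ?enorm_ge0// !sqr_enorm.
pose W := B^T *m invmx (gram B).
have ptK z : pt z *m W = map_mx intr z.
  by rewrite /pt /W !mulmxA -(mulmxA _ B) mulmxK// unitmxE unitfE.
pose z0 : 'rV[int]_m.+1 := delta_mx 0 0.
have z00 : z0 != 0 by apply/eqP => /rowP/(_ 0)/eqP; rewrite !mxE !eqxx.
pose M := enorm (pt z0) * \sum_j \sum_i `|W j i|.
pose N := Num.bound M.
(* Ordinals shifted by [N] encode the integers from -N to N, so the candidates form a finite
   type. *)
pose dec (f : 'rV['I_(N + N).+1]_m.+1) : 'rV[int]_m.+1 :=
  map_mx (fun k : 'I_(N + N).+1 => (k : nat)%:Z - N%:Z) f.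
have small z : enorm (pt z) <= enorm (pt z0) -> exists f, z = dec f.
  move=> zz0.
  have zN i : `|z 0 i| <= N%:Z.
    rewrite -(ler_int R) intr_norm.
    have -> : (z 0 i)%:~R = (map_mx intr z : 'rV[R]_m.+1) 0 i by rewrite mxE.
    rewrite -ptK mxE; apply: le_trans (ler_norm_sum _ _ _) _.
    have MN : M <= N%:R.
      apply/ltW/archi_boundP/mulr_ge0; first exact: enorm_ge0.
      by apply: sumr_ge0 => ? _; exact: sumr_ge0.
    apply: le_trans MN; rewrite /M mulr_sumr; apply: ler_sum => j _.
    rewrite normrM ler_pM// ?(le_trans (@coord_le_enorm _ _ (pt z) j))//.
    by rewrite (bigD1 i)//= lerDl sumr_ge0.
  exists (\row_i inord `|(z 0 i + N%:Z)%R|%N).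
  apply/rowP => i; rewrite !mxE.
  have := zN i; rewrite ler_norml => /andP[zl zr].
  have zp : 0 <= z 0 i + N%:Z by rewrite -lerBlDr sub0r.
  rewrite inordK; first by rewrite gez0_abs// addrK.
  by rewrite ltnS -lez_nat gez0_abs// PoszD lerD2r.
have [f0 f0E] := small _ (lexx _).
have decf0 : dec f0 != 0 by rewrite -f0E.
have [/= f fN0 fmin] := Order.TotalTheory.arg_minP
  (P := fun f => dec f != 0) (fun f => enorm (pt (dec f))) decf0.
exists (dec f) => // z zN0.
have [zz0|/ltW] := leP (enorm (pt z)) (enorm (pt z0)).
  by have [g zg] := small _ zz0; rewrite zg; apply: fmin; rewrite -zg.
by apply: le_trans; rewrite f0E; exact: fmin.
Qed.

(** Puts a vector proportional to [z] into a basis of the integer lattice. In the Smith normal form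
    of the one-row matrix [z] the left factor is a scalar and the diagonal has a single entry, so
    [z] is a multiple of the first row of the right factor. *)
Lemma primitive_completion {m} (z : 'rV[int]_m.+1) : z != 0 ->
  exists (U : 'M[int]_m.+1) (k : int), [/\ U \in unitmx, k != 0 & z = k *: row 0 U].
Proof.
move=> z0; have [l _ [U Uu [d _ zE]]] := int_Smith_normal_form z.
exists U, (l 0 0 * d`_0).
have {}zE : z = (l 0 0 * d`_0) *: row 0 U.
  rewrite zE [l in LHS]mx11_scalar mul_scalar_mx -scalemxAl -scalerA; congr (_ *: _).
  rewrite [in RHS]rowE scalemxAl; congr (_ *m _).
  apply/rowP => j; rewrite !mxE eqxx /=.
  by case: j => -[|j]//= ?; rewrite ?mulr1 ?mulr0.
by split=> //; apply: contraNneq z0; rewrite zE => ->; rewrite scale0r.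
Qed.

Lemma round_half (x : R) : exists k : int, (x - k%:~R) ^+ 2 <= 4^-1.
Proof.
exists (Num.floor (x + 2^-1)).
have := floor_itv (x + 2^-1); rewrite intrD => /andP[].
set k := (_%:~R); nra.
Qed.

(* Hermite reduction: start from a shortest basis vector, reduce the projection
   of the lattice to its orthogonal complement, and lift each reduced vector c
   to a vector of square norm at most c.c + b.b/4; the latter being at least
   b.b, it is at most 4/3 c.c. *)
Lemma hermite_reduced {m n} (B : 'M[R]_(m, n)) : \det (gram B) != 0 ->
  exists2 T : 'M[int]_m, T \in unitmx &
    let B' := map_mx intr T *m B in
    \prod_i dotv (row i B') (row i B') <= (4 / 3) ^+ 'C(m, 2) * \det (gram B).
Proof.
elim: m B => [|m IH] B dB.
  by exists 1%:M; rewrite ?unitmx1//= big_ord0 det_mx00 expr0 mulr1.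
have [z zN0 zmin] := gram_shortest B dB.
have [U [k [Uu kN0 zE]]] := primitive_completion z zN0.
pose q (z : 'rV[int]_m.+1) := dotv (map_mx intr z *m B) (map_mx intr z *m B).
(* Since [z] is a nonzero integer multiple of [row 0 U], that row gives a vector no longer than the
   shortest one. *)
have qU z' : z' != 0 -> q (row 0 U) <= q z'.
  move=> z'0; apply: le_trans (zmin z' z'0); rewrite zE map_mxZ -scalemxAl.
  rewrite /q !dotvE mulrA ler_peMl ?dotv_ge0// -intrM ler1z -gtz0_ge1.
  by rewrite -expr2 exprn_even_gt0.
rewrite -[m.+1]/(1 + m)%N in B dB U Uu k kN0 z zE zN0 zmin q qU *.
have detU (T : 'M[int]_(1 + m)) : T \in unitmx ->
    \det (gram (map_mx intr T *m B)) = \det (gram B).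
  rewrite /gram trmx_mul mulmxA -(mulmxA _ B) !det_mulmx det_tr det_map_mx.
  rewrite unitmxE => /orP[]/eqP->; ring.
pose B1 := map_mx intr U *m B : 'M[R]_(1 + m, n).
have dB1 : \det (gram B1) != 0 by rewrite detU.
have bE : usubmx B1 = map_mx intr (row 0 U) *m B.
  rewrite map_row -row_mul; apply/rowP => j; rewrite !mxE; apply: eq_bigr => i _.
  by congr (_ * _); rewrite !mxE; congr (U _ _)%:~R; exact/val_inj.
have b0 : usubmx B1 != 0.
  apply: contraNneq dB1 => b0.
  rewrite eq_le; have /andP[-> h] := hadamard_gram B1; rewrite andbT.
  apply: (le_trans h); rewrite big_ord_recl.
  have -> : row ord0 B1 = usubmx B1.
    by apply/rowP => j; rewrite mxE [RHS]mxE; congr (B1 _ _); exact/val_inj.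
  by rewrite b0 dotv0 mul0r.
have [B1E Cb dE] := gram_schmidt_step B1 b0.
set b := usubmx B1 in bE b0 B1E Cb dE *.
set mu := _ *: (_ *m _) in B1E Cb dE *; set C := _ - _ in B1E Cb dE *.
have dC : \det (gram C) != 0 by move: dB1; rewrite dE mulf_eq0 negb_or => /andP[].
have [T' T'u T'le] := IH C dC.
pose nu : 'cV[R]_m := map_mx intr T' *m mu.
have [r rP] := choice (fun i => round_half (nu i 0)).
pose rv : 'cV[int]_m := \col_i r i.
(* After the base change [U], this keeps [b], applies [T'] to the other rows and subtracts from each
   the integer multiple of [b] that brings its [b]-coefficient to absolute value at most 1/2. *)
pose T : 'M[int]_(1 + m) := block_mx 1%:M 0 (- rv) T' *m U.
have Tu : T \in unitmx.
  by rewrite unitmxE det_mulmx det_lblock det1 mul1r unitrM -!unitmxE T'u.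
exists T => //=.
have TBE : map_mx intr T *m B =
    col_mx b (map_mx intr T' *m C + (nu - map_mx intr rv) *m b).
  rewrite map_mxM -mulmxA -/B1 B1E map_block_mx map_mx1 map_mx0 map_mxN.
  rewrite mul_block_col !mul1mx mul0mx addr0 mulmxDr mulmxA -/nu mulmxBl.
  by rewrite mulNmx; congr col_mx; rewrite addrC addrA addrAC.
set C' := map_mx intr T' *m C in TBE T'le *.
have C'b : C' *m b^T = 0 by rewrite -mulmxA Cb mulmx0.
have rowT i : row i T != 0.
  apply/eqP => /(congr1 (mulmx^~ (invmx T))).
  rewrite -row_mul mulmxV// mul0mx => /rowP/(_ i)/eqP.
  by rewrite !mxE eqxx oner_eq0.
have bmin i : dotv b b <=
    dotv (row i (map_mx intr T *m B)) (row i (map_mx intr T *m B)).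
  by rewrite row_mul -map_row bE; exact: qU.
rewrite big_ord_recl -(detU U Uu) -/B1 dE binS bin1.
have -> : row ord0 (map_mx intr T *m B) = b.
  rewrite TBE; apply: etrans (row_id 0 b).
  rewrite -(rowKu 0 b (C' + (nu - map_mx intr rv) *m b)); congr row.
  exact/val_inj.
rewrite mulrCA; apply: ler_wpM2l; first exact: dotv_ge0.
rewrite exprD -mulrA mulrCA.
(* Each of the [m] projected rows costs a factor 4/3, matching ['C(m.+1, 2) = 'C(m, 2) + m]. *)
apply: (@le_trans _ _ (\prod_(i < m) ((4 / 3) * dotv (row i C') (row i C')))).
  apply: ler_prod => i _; rewrite dotv_ge0/=.
  have := bmin (lift ord0 i).
  have -> : row (lift ord0 i) (map_mx intr T *m B) =
      row i (C' + (nu - map_mx intr rv) *m b).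
    by rewrite TBE -(rowKd i b); congr row; exact/val_inj.
  rewrite dotv_row_orthogonalD//.
  have -> : (nu - map_mx intr rv) i 0 = nu i 0 - (r i)%:~R by rewrite !mxE.
  have := rP i; have := dotv_ge0 b; move: (_ ^+ 2) => x; nra.
rewrite big_split/= prodr_const card_ord; apply: ler_wpM2l => //.
Qed.

End ReducedBasis.

(** * Support hyperplanes and illumination of smooth bodies *)

Section ConvexSets.
Context {R : realType} {n : nat}.
Implicit Types (K : set 'rV[R]_n) (a u v w x y z p q d : 'rV[R]_n) (t : R).

Lemma convex_set_segment {K x y t} :
  convex_set (K : set (convex_lmodType 'rV[R]_n)) ->
  K x -> K y -> 0 <= t <= 1 -> K ((1 - t) *: x + t *: y).
Proof.
move=> cK Kx Ky /andP[t0 t1].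
by have := cK y x (Itv01 t0 t1); rewrite !inE /= addrC; apply.
Qed.

Lemma interior_translate K v z : (translate K v)° z <-> K° (z - v).
Proof.
have shift K' v' z' : K'° z' -> (translate K' v')° (z' + v').
  move=> /(nbhsB v'); rewrite addrC /translate.
  by apply: filterS => _ [x Kx <-]; exists x; rewrite // addrC.
split=> [/(shift _ (- v))|/(shift _ v)]; last by rewrite subrK.
have -> // : translate (translate K v) (- v) = K.
apply/seteqP; split=> [_ [_ [x Kx <-] <-]|x Kx]; first by rewrite addrK.
by exists (x + v); [exists x|rewrite addrK].
Qed.

(** The homothety with centre [p] and ratio [t] maps [K] into itself and [z] to [m]; its inverse [f]
    is continuous, so a neighbourhood of [z] in [K] yields one of [m]. *)
Lemma interior_segment {K p z t} :
  convex_set (K : set (convex_lmodType 'rV[R]_n)) ->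
  K p -> K° z -> 0 < t <= 1 -> K° ((1 - t) *: p + t *: z).
Proof.
move=> cK Kp Kz /andP[t0 t1]; set m := _ + _.
pose f x := t^-1 *: (x - (1 - t) *: p).
have fm : f m = z by rewrite /f /m addrAC subrr add0r scalerA mulVf ?gt_eqF// scale1r.
have c : {for m, continuous f}.
  apply: continuousZl_tmp.
  have : {for m, continuous (fun x : 'rV[R]_n => x - (1 - t) *: p)}.
    by apply: continuousB; [exact: cvg_id|exact: cst_continuous].
  done.
rewrite /interior -fm in Kz *; have := c _ Kz : nbhs m (f @^-1` K).
apply: filterS => x /= Kfx.
have -> : x = (1 - t) *: p + t *: f x.
  by rewrite /f scalerA mulfV ?gt_eqF// scale1r addrC subrK.
by apply: convex_set_segment => //; rewrite ltW.
Qed.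

Lemma interior_dotv_lt {K a} {b : R} {z} : a != 0 ->
  (forall x, K x -> dotv a x <= b) -> K° z -> dotv a z < b.
Proof.
move=> a0 Kab Kz.
have c : {for 0, continuous (fun t : R => z + t *: a)}.
  by apply: cvgD; [exact: cvg_cst|apply: cvgZr_tmp; exact: cvg_id].
have : \forall t \near (0 : R), K (z + t *: a).
  by apply: c; rewrite scale0r addr0.
move=> /nbhs_ballP[e /= e0 eK].
have /Kab : K (z + (e / 2) *: a).
  by apply: eK; rewrite /ball/= sub0r normrN gtr0_norm; lra.
apply: lt_le_trans; rewrite !dotvE ltrDl mulr_gt0 ?dotv_gt0//; lra.
Qed.

Lemma dotv_closure_ge0 {A : set 'rV[R]_n} {w u} :
  (forall x, A x -> 0 <= dotv w x) -> closure A u -> 0 <= dotv w u.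
Proof.
move=> Aw; have cl : closed (dotv w @^-1` [set r | 0 <= r]).
  apply: preimage_closed; last exact: closed_ge.
  by move=> x _; exact: continuous_dotv.
by move=> /(closure_subset Aw); rewrite -((closure_id _).1 cl).
Qed.

(** If [p - q] and [x - q] made an acute angle at a nearest point [q] to [p], a short move from [q]
    towards [x] would come closer to [p]. *)
Lemma nearest_point {K p} :
  compact K -> convex_set (K : set (convex_lmodType 'rV[R]_n)) -> K !=set0 ->
  exists2 q, K q & forall x, K x -> dotv (p - q) (x - q) <= 0.
Proof.
move=> Kc Kconv K0.
have cf : continuous (fun x : 'rV[R]_n => enorm (p - x)).
  move=> x; apply: (@continuous_comp _ _ _ (fun x : 'rV[R]_n => p - x)).
    by apply: continuousB; [exact: cst_continuous|exact: cvg_id].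
  exact: enorm_continuous.
have [q] := compact_EVT_min K0 Kc (continuous_subspaceT cf).
rewrite inE => Kq qmin; exists q => // x Kx; rewrite leNgt; apply/negP => xq0.
set D := dotv (x - q) (x - q).
have D0 : 0 <= D by exact: dotv_ge0.
(* The cap 1 keeps the moved point in [K]; the quotient keeps the quadratic term [s ^+ 2 * D] below
   the linear gain. *)
pose s := Num.min 1 (dotv (p - q) (x - q) / (D + 1)).
have s0 : 0 < s by rewrite lt_min ltr01 divr_gt0//; lra.
have s1 : s <= 1 by rewrite ge_min lexx.
have sD : s * (D + 1) <= dotv (p - q) (x - q).
  by rewrite -ler_pdivlMr ?ge_min ?lexx ?orbT//; lra.
have Ks : K (q + s *: (x - q)).
  have -> : q + s *: (x - q) = (1 - s) *: q + s *: x.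
    by rewrite scalerBr scalerBl scale1r addrA addrAC.
  by apply: convex_set_segment => //; rewrite ltW.
have := qmin (q + s *: (x - q)); rewrite inE => /(_ Ks).
rewrite -ler_sqr ?nnegrE ?enorm_ge0// !sqr_enorm opprD addrA.
move: sD D0 xq0; rewrite /D; clearbody s; move: (x - q) (p - q) => y r.
rewrite !dotvE (dotvC y r); nra.
Qed.

(* The vectors w such that y + t w leaves K for all t > 0 lie outside the
   interior of the tangent cone of K at y; the supporting functional u is a
   limit of unit normals at the points of K nearest to y + t w, as t -> 0. *)
Lemma support_direction K y w :
  compact K -> convex_set (K : set (convex_lmodType 'rV[R]_n)) -> K y ->
  (forall t, 0 < t -> ~ K (y + t *: w)) ->
  exists u, [/\ u != 0, 0 <= dotv u w & forall x, K x -> dotv u x <= dotv u y].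
Proof.
move=> Kc Kconv Ky Kw.
(* With t = 1/(k+1), the witness is the vector from the nearest point of [K] to [y + t *: w], scaled
   to sup norm 1. *)
have ex (k : nat) : exists u, [/\ `|u| = 1, 0 <= dotv u w &
    forall x, K x -> dotv u x <= dotv u y + k.+1%:R^-1 * dotv u w].
  set t : R := k.+1%:R^-1; have t0 : 0 < t by rewrite invr_gt0.
  have [q Kq qP] := @nearest_point K (y + t *: w) Kc Kconv (ex_intro _ y Ky).
  set r := y + t *: w - q in qP.
  have r0 : r != 0 by apply/eqP => /subr0_eq E; apply: (Kw t t0); rewrite E.
  have lt x : K x -> dotv r x < dotv r y + t * dotv r w.
    move=> Kx; have := qP x Kx; have : 0 < dotv r r by rewrite dotv_gt0.
    by rewrite {2}/r !dotvE; lra.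
  clearbody r; have nr0 : 0 < `|r|^-1 by rewrite invr_gt0 normr_gt0.
  exists (`|r|^-1 *: r); split.
  - by rewrite normrZ normfV normr_id mulVf// normr_eq0.
  - rewrite dotvE mulr_ge0 ?(ltW nr0)//.
    have := lt y Ky; rewrite ltrDl pmulr_rgt0//; exact: ltW.
  - move=> x Kx; rewrite !dotvE mulrCA -mulrDr ler_pM2l//; exact/ltW/lt.
have [u uP] := choice ex.
pose S := [set u : 'rV[R]_n | `|u| = 1].
have Sc : compact S.
  apply: bounded_closed_compact.
    by exists 1; split=> // M M1 x /= ->; exact: ltW.
  apply: (@preimage_closed _ _ (fun u : 'rV[R]_n => `|u|) [set r | r = 1]).
    by move=> x _; exact: norm_continuous.
  exact: closed_eq.
have FS : (u @ \oo) S by exists 0 => // k _; case: (uP k).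
have [v [Sv]] := Sc (u @ \oo) _ FS; rewrite clusterE => clv.
have v0 : v != 0 by rewrite -normr_gt0 Sv.
have cl N : closure (u @` [set k | (N <= k)%N]) v.
  by apply: clv; exists N => // k /= Nk; exists k.
have vw : 0 <= dotv v w.
  rewrite dotvC; apply: dotv_closure_ge0 (cl 0) => _ [k _ <-].
  by rewrite dotvC; case: (uP k).
exists v; split=> // x Kx; rewrite -subr_ge0.
(* For k >= N the bound with 1/(k+1) weakens to one with 1/(N+1), because [dotv (u k) w] is
   nonnegative; for fixed [N] this is a closed condition and passes to the cluster point [v]. *)
have le N : 0 <= dotv (y - x + N.+1%:R^-1 *: w) v.
  apply: dotv_closure_ge0 (cl N) => _ [k /= Nk <-].
  have [_ uw /(_ x Kx)] := uP k.
  have : (k.+1%:R^-1 : R) * dotv (u k) w <= N.+1%:R^-1 * dotv (u k) w.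
    by apply: ler_wpM2r => //; rewrite lef_pV2 ?posrE// ler_nat.
  rewrite [dotv (_ + _) _]dotvC !dotvE.
  by move: (k.+1%:R^-1 * _) (N.+1%:R^-1 * _) => p q; lra.
rewrite leNgt; apply/negP => yx0.
pose c := dotv v x - dotv v y; have c0 : 0 < c by rewrite /c; lra.
have := archi_boundP (divr_ge0 vw (ltW c0)); set N := Num.bound _ => Nb.
have := le N; rewrite dotvC !dotvE.
have : N.+1%:R^-1 * dotv v w < c.
  rewrite mulrC ltr_pdivrMr// -ltr_pdivrMl// mulrC.
  by apply: lt_trans Nb _; rewrite ltr_nat.
rewrite /c; move: (_^-1 * _) => r; lra.
Qed.

(** The component [z] of [u] orthogonal to [a] is a direction of the common hyperplane, hence
    orthogonal to [u] as well, and so to itself. *)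
Lemma hyperplane_normal a u y : a != 0 ->
  hyperplane u (dotv u y) = hyperplane a (dotv a y) ->
  u = (dotv u a / dotv a a) *: a.
Proof.
move=> a0 E; have aa : dotv a a != 0 by rewrite dotv_eq0.
apply/eqP; rewrite -subr_eq0; set c := _ / _; set z := u - _.
have az : dotv a z = 0 by rewrite /z !dotvE (dotvC a u) mulfVK// subrr.
have : hyperplane u (dotv u y) (y + z).
  by rewrite E /hyperplane/= dotvDr az addr0.
rewrite /hyperplane/= dotvDr => /eqP; rewrite -subr_eq0 addrAC subrr add0r => uz.
have zz : dotv z z = dotv u z - c * dotv a z by rewrite -dotvZl -dotvNl -dotvDl.
by rewrite -dotv_eq0 zz az mulr0 subr0.
Qed.

(* Were the line to miss the interior of K, a second support hyperplane at y
   would arise from a direction w pointing strictly inside the half space of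
   the given one. *)
Lemma smooth_illuminated {K a y} x :
  convex_body K -> smooth_boundary K -> boundary K y -> a != 0 ->
  (forall z, K z -> dotv a z <= dotv a y) -> dotv a y < dotv a x ->
  illuminates_point K x y.
Proof.
move=> [Kc Kconv [z0 Kz0]] Ks yb a0 Kay ayx.
have Ky : K y.
  case: yb; have /closure_id <- // := compact_closed (@norm_hausdorff _ _) Kc.
have lt z : K° z -> dotv a z < dotv a y := interior_dotv_lt a0 Kay.
split.
- by apply: contraTneq ayx => ->; rewrite ltxx.
- rewrite -subset0 => _ [[t /= /andP[t0 t1] <-] /lt]; rewrite !dotvE; nra.
pose d := x - y; have ad : 0 < dotv a d by rewrite /d !dotvE; lra.
(* The constant [c] makes [dotv a w] equal to -1. *)
pose c := (dotv a (y - z0) + 1) / dotv a d.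
pose w := y - z0 - c *: d.
have aw : dotv a w < 0.
  rewrite /w dotvDr dotvNr dotvZr /c mulfVK ?gt_eqF//; lra.
(* Otherwise [support_direction] gives a normal [u] with [0 <= dotv u w]; smoothness makes it a
   multiple of [a], positive because both functionals are smaller at [z0] than at [y], against
   [dotv a w < 0]. *)
have [t t0 Kt] : exists2 t : R, 0 < t & K (y + t *: w).
  apply: contrapT => H.
  have Kw t : 0 < t -> ~ K (y + t *: w) by move=> t0 Kt; apply: H; exists t.
  have [u [u0 uw Ku]] := support_direction K y w Kc Kconv Ky Kw.
  have [H0 [_ uniq]] := Ks y yb.
  have Ha : H0 = hyperplane a (dotv a y) by apply: uniq; exists a, (dotv a y).
  have Hu : H0 = hyperplane u (dotv u y) by apply: uniq; exists u, (dotv u y).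
  have uE := hyperplane_normal a u y a0 (etrans (esym Hu) Ha).
  move: (_ / _) uE => e uE.
  have e0 : 0 < e.
    have := interior_dotv_lt u0 Ku Kz0; have := lt _ Kz0.
    rewrite uE !dotvE; nra.
  by move: uw; rewrite uE dotvE; nra.
(* With these weights the [z0] terms cancel, leaving the point y - (t c / (1 + t)) d of the line; it
   is interior because [z0] is. *)
exists ((1 - t / (1 + t)) *: (y + t *: w) + (t / (1 + t)) *: z0); split; last first.
  apply: interior_segment => //; apply/andP; split; first by rewrite divr_gt0//; lra.
  by rewrite ler_pdivrMr; lra.
have t1 : 1 + t != 0 by rewrite gt_eqF//; lra.
exists (1 + t * c / (1 + t)) => //; apply/rowP => j; rewrite !mxE.
by field.
Qed.

End ConvexSets.

(** * Simplices spanned by a reduced basis *)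

Section Illumination.
Context {R : realType} {n : nat}.
Implicit Types (K L : set 'rV[R]_n) (x y v : 'rV[R]_n).

Lemma boundary_translate K v y :
  compact K -> boundary (translate K v) y -> K (y - v) /\ boundary K (y - v).
Proof.
move=> Kc [yc yi].
have Kvc : compact (translate K v).
  apply: continuous_compact => //; apply: continuous_subspaceT => x.
  by apply: continuousD; [exact: cvg_id|exact: cst_continuous].
have [x Kx xy] : translate K v y.
  by move: yc; rewrite -((closure_id _).1 (compact_closed (@norm_hausdorff _ _) Kvc)).
have Kyv : K (y - v) by rewrite -xy addrK.
split=> //; split; first exact: subset_closure.
by move=> /interior_translate.
Qed.

Lemma illuminates_point_translate K v x y :
  illuminates_point K (x - v) (y - v) -> illuminates_point (translate K v) x y.
Proof.
have shift (t : R) : (1 - t) *: (x - v) + t *: (y - v) =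
    (1 - t) *: x + t *: y - v.
  by apply/rowP => j; rewrite !mxE; ring.
move=> [xy seg [_ [[t _ <-] lK]]]; split.
- by apply: contra_neq xy => ->.
- rewrite -subset0 => _ [[s s01 <-] /interior_translate].
  rewrite -shift => Ks.
  have : (segment (x - v) (y - v) `&` K°) ((1 - s) *: (x - v) + s *: (y - v)).
    by split=> //; exists s.
  by rewrite seg.
- exists ((1 - t) *: x + t *: y); split; first by exists t.
  by apply/interior_translate; rewrite -shift.
Qed.

(** Cramer's rule, by Laplace expansion along the replaced row. *)
Lemma cofactor_replace_row (B : 'M[R]_n) (w : 'rV[R]_n) i :
  \det (\matrix_j (if j == i then w else row j B)) = (w *m \adj B) 0 i.
Proof.
rewrite (expand_det_row _ i) mxE; apply: eq_bigr => j _.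
rewrite !mxE eqxx; congr (_ * _); rewrite /cofactor; congr (_ * \det _).
apply/matrixP => k l; rewrite !mxE.
by rewrite eq_sym (negPf (neq_lift _ _)) mxE.
Qed.

Lemma coordinate_le (B : 'M[R]_n) (w : 'rV[R]_n) i : B \in unitmx ->
  `|(w *m invmx B) 0 i| * `|\det B| <=
  enorm w * \prod_(j | j != i) enorm (row j B).
Proof.
move=> Bu; rewrite -normrM.
have -> : (w *m invmx B) 0 i * \det B = (w *m \adj B) 0 i.
  rewrite /invmx Bu -scalemxAr [X in X * _]mxE mulrAC mulVf ?mul1r//.
  by rewrite -unitfE -unitmxE.
rewrite -cofactor_replace_row; apply: le_trans (hadamard _) _.
rewrite (bigD1 i)//= rowK eqxx ler_wpM2l ?enorm_ge0//.
by apply: ler_prod => j /negPf ji; rewrite rowK ji enorm_ge0 lexx.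
Qed.

(** The point [c *m B] is interior to the simplex with vertices 0 and [t *: row i B], and a nonzero
    linear functional has no maximum over the simplex at an interior point. *)
Lemma simplex_vertex_beyond (B : 'M[R]_n) (t : R) (a c : 'rV[R]_n) :
  B \in unitmx -> a != 0 -> (forall i, 0 < c 0 i) -> \sum_i c 0 i < t ->
  dotv a (c *m B) < 0 \/ exists i, dotv a (c *m B) < dotv a (t *: row i B).
Proof.
move=> Bu a0 c0 ct; apply: contrapT => /not_orP[/negP]; rewrite -leNgt => p0 H.
have le i : t * dotv a (row i B) <= dotv a (c *m B).
  by rewrite -dotvZr leNgt; apply/negP => lt; apply: H; exists i.
have pE : dotv a (c *m B) = \sum_i c 0 i * dotv a (row i B).
  rewrite mulmx_sum_row; elim/big_rec2: _ => [|i x y _ <-]; first by rewrite dotv0.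
  by rewrite dotvDr dotvZr.
have t0 : 0 < t by apply: le_lt_trans ct; apply: sumr_ge0 => i _; exact: ltW.
(* Summing the inequalities [le] with weights [c 0 i] bounds [t] times this value by [\sum_i c 0 i]
   times it, and the sum is below [t]. *)
have {}p0 : dotv a (c *m B) = 0.
  apply/eqP; rewrite eq_le p0 andbT.
  rewrite -(pmulr_rle0 _ (_ : 0 < t - \sum_i c 0 i)) ?subr_gt0//.
  rewrite mulrBl subr_le0 {1}pE mulr_sumr mulr_suml; apply: ler_sum => i _.
  by rewrite mulrCA ler_pM2l.
have b0 i : dotv a (row i B) <= 0 by rewrite -(pmulr_rle0 _ t0) -[leRHS]p0.
have Bi0 i : dotv a (row i B) = 0.
  apply/eqP; rewrite eq_le b0/=.
  move: pE; rewrite p0 => /esym/eqP; rewrite -oppr_eq0 -sumrN psumr_eq0 => [|j _].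
    move=> /allP/(_ i (mem_index_enum i)); rewrite /= oppr_eq0 mulf_eq0.
    by rewrite gt_eqF//= => /eqP->.
  by rewrite oppr_ge0 pmulr_rle0.
move: a0; rewrite -dotv_eq0.
have aB : a *m B^T = 0.
  apply/rowP => i; rewrite [RHS]mxE -(Bi0 i) dotv_mx !mxE; apply: eq_bigr => j _.
  by rewrite !mxE.
have -> : a = 0 by rewrite -(mulmxK (_ : B^T \in unitmx) a) ?unitmx_tr// aB mul0mx.
by rewrite dotv0 eqxx.
Qed.

(** The remaining factor is at least 1 because n + 2^(n-1) >= 2 and 4n >= 2(n+1). *)
Lemma C_ge : (0 < n)%N -> n%:R <= C_ R n.
Proof.
move=> n0; rewrite /C_ -!mulrA ler_peMr//.
have n1 : (1 : R) <= n%:R by rewrite ler1n.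
have s0 : 0 < Num.sqrt (2 * n.+1%:R : R) by rewrite sqrtr_gt0 mulr_gt0.
rewrite mulrA ler_pdivlMr// mul1r.
have p1 : (1 : R) <= 2 ^+ (n - 1) by apply: exprn_ege1; rewrite ler1n.
apply: (@le_trans _ _ (Num.sqrt n%:R * 2)).
  rewrite -ler_sqr ?nnegrE ?mulr_ge0 ?sqrtr_ge0// exprMn !sqr_sqrtr ?mulr_ge0//.
  by rewrite -natr1 expr2; lra.
by rewrite ler_wpM2l ?sqrtr_ge0//; lra.
Qed.

Lemma enorm_simplex_le (B : 'M[R]_n) (M t : R) (c : 'rV[R]_n) :
  0 <= M -> (forall i, enorm (row i B) <= M) -> (forall i, 0 <= c 0 i) ->
  \sum_i c 0 i <= t -> enorm (c *m B) <= t * M.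
Proof.
move=> M0 BM c0 ct; rewrite mulmx_sum_row; apply: (le_trans (ler_enorm_sum _ _ _ _)).
apply: (@le_trans _ _ (\sum_i c 0 i * M)).
  apply: ler_sum => i _; rewrite enormZ ger0_norm//; exact: ler_wpM2l.
by rewrite -mulr_suml ler_wpM2r.
Qed.

Lemma lattice_reduced_basis L : full_rank_lattice L ->
  exists2 B, lattice_basis L B &
    \prod_i enorm (row i B) <= (4 / 3) ^+ 'C(n, 2) * lattice_det L.
Proof.
move=> [B0 LB0]; have [B0u LE] := LB0.
have dB0 : \det (gram B0) = `|\det B0| ^+ 2.
  by rewrite /gram det_mulmx det_tr real_normK ?num_real// expr2.
have [|T Tu /= TB] := @hermite_reduced R n n B0.
  by rewrite dB0 expf_neq0// normr_eq0 -unitfE -unitmxE.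
have TuR : map_mx intr T \in @unitmx R n.
  by rewrite unitmxE det_map_mx rmorph_unit// -unitmxE.
exists (map_mx intr T *m B0).
  split; first by rewrite unitmx_mul TuR.
  rewrite LE; apply/seteqP; split=> _ [z _ <-].
    by exists (z *m invmx T) => //; rewrite mulmxA -map_mxM mulmxKV.
  by exists (z *m T) => //; rewrite map_mxM mulmxA.
rewrite (lattice_detE LB0).
(* Hermite reduction bounds the squared product with a single power of this factor; being at least
   1, the factor may be replaced by its square. *)
have E1 : (1 : R) <= (4 / 3) ^+ 'C(n, 2) by apply: exprn_ege1; lra.
have E0 := le_trans ler01 E1.
rewrite -ler_sqr ?nnegrE ?mulr_ge0 ?prodr_ge0// => [|i _]; last exact: enorm_ge0.
rewrite -prodrXl; under eq_bigr do rewrite sqr_enorm.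
apply: (le_trans TB); rewrite dB0 [leRHS]exprMn ler_wpM2r ?sqr_ge0//.
by rewrite expr2 ler_peMl.
Qed.

End Illumination.

(** * Illumination of a translate by the vertices of a dilated basis simplex *)

Theorem theorem1p2 (R : realType) (n : nat) (n_ge1 : (1 <= n)%N)
    (K : set 'rV[R]_n) (K_body : convex_body K) (K_smooth : smooth_boundary K)
    (L : set 'rV[R]_n) (L_lattice : full_rank_lattice L) :
  exists (S : set 'rV[R]_n) (v : 'rV[R]_n),
    [/\ S `<=` L,
        (S #= `I_n.+1)%card,
        illuminates S (translate K v) &
        illumination_distance S (translate K v) <=
          2 * (4 / 3) ^+ ((n * (n - 1)) %/ 2)%N *
          (Num.floor ((4 / 3) ^+ ((n * (n - 1)) %/ 2)%N *
                      (C_ R n * diameter K / lattice_min_norm L) + 1))%:~R *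
          (lattice_det L / lattice_min_norm L ^+ (n - 1))].
Proof.
have [Kc Kconv [z0 Kz0]] := K_body.
have [B LB prodB] := lattice_reduced_basis L L_lattice.
have [Bu LE] := LB.
have [[l0 [Ll0 l00 lamE]] lamP] := lattice_min_normP n_ge1 L_lattice.
have -> : ((n * (n - 1)) %/ 2)%N = 'C(n, 2) by rewrite bin2 divn2 subn1.
have DP x y : K x -> K y -> enorm (x - y) <= diameter K.
  have K0 : K !=set0 by exists z0; exact: interior_subset.
  by have [_] := max_distanceP K0 Kc K0 Kc; exact.
set E := (4 / 3) ^+ 'C(n, 2) in prodB *.
set lam := lattice_min_norm L in lamE lamP *.
set D := diameter K in DP *; set det := lattice_det L in prodB *.
have E0 : 0 < E by rewrite exprn_gt0// divr_gt0.
have lam0 : 0 < lam by rewrite lamE enorm_gt0.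
have det0 : 0 < det by rewrite /det (lattice_detE LB) normr_gt0 -unitfE -unitmxE.
have D0 : 0 <= D.
  by apply: le_trans (DP z0 z0 _ _); rewrite ?enorm_ge0//; exact: interior_subset.
have rowB i : lam <= enorm (row i B).
  apply: lamP.
    by rewrite LE; exists (delta_mx 0 i); rewrite // map_delta_mx -rowE.
  apply/eqP => Bi0; have := mulmxV Bu => /(congr1 (row i)).
  rewrite row_mul Bi0 mul0mx => /rowP/(_ i)/eqP.
  by rewrite !mxE eqxx eq_sym oner_eq0.
(* Bound for each basis vector: the other n - 1 factors of the product are at least [lam]. *)
set M := E * (det / lam ^+ (n - 1)).
have M0 : 0 <= M.
  by rewrite mulr_ge0 ?(ltW E0)// divr_ge0 ?(ltW det0)// exprn_ge0// ltW.
have rowM i : enorm (row i B) <= M.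
  rewrite /M mulrA ler_pdivlMr ?exprn_gt0//; apply: le_trans prodB.
  rewrite (bigD1 i)//= ler_wpM2l ?enorm_ge0//.
  have -> : lam ^+ (n - 1) = \prod_(j | j != i) lam.
    by rewrite prodr_const cardC1 card_ord subn1.
  by apply: ler_prod => j _; rewrite ltW//=.
pose c (x : 'rV[R]_n) i := (x *m invmx B) 0 i.
(* Bound for the width of [K] in each coordinate. *)
pose W := D * E / lam.
have W0 : 0 <= W by rewrite divr_ge0 ?mulr_ge0 ?(ltW E0) ?(ltW lam0).
have width x y i : K x -> K y -> c x i - c y i <= W.
  move=> Kx Ky; have -> : c x i - c y i = c (x - y) i by rewrite /c mulmxBl !mxE.
  apply: le_trans (ler_norm _) _; rewrite /W ler_pdivlMr// -(ler_pM2r det0).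
  have := coordinate_le B (x - y) i Bu.
  rewrite -(lattice_detE LB) -/det -/(c _ i) => H.
  rewrite mulrAC -[D * E * det]mulrA.
  apply: (@le_trans _ _ (`|c (x - y) i| * det * enorm (row i B))).
    by rewrite ler_wpM2l// mulr_ge0// ltW.
  apply: le_trans (ler_wpM2r (enorm_ge0 _) H) _.
  rewrite -mulrA [_ * enorm _]mulrC.
  rewrite -(bigD1 (P := xpredT) (F := fun i => enorm (row i B)) i)//=.
  apply: ler_pM; rewrite ?enorm_ge0 ?DP//.
  by apply: prodr_ge0 => j _; exact: enorm_ge0.
set f := Num.floor _; set t : R := f%:~R.
(* The floor of s + 1 exceeds s, so the inequality is strict even when [W] is 0. *)
have tW : n%:R * W < t.
  have /andP[_] := floor_itv (E * (C_ R n * D / lam) + 1); rewrite -/f intrD -/t.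
  rewrite ltrD2r; apply: le_lt_trans; rewrite /W.
  have -> : E * (C_ R n * D / lam) = C_ R n * (D * E / lam) by ring.
  by rewrite ler_wpM2r// C_ge.
have t0 : 0 < t by apply: le_lt_trans tW; rewrite mulr_ge0.
pose m i := inf [set c x i | x in K].
have cm x i : K x -> 0 <= c x i - m i <= W.
  move=> Kx; rewrite subr_ge0 lerBlDr -lerBlDl; apply/andP; split.
    apply: ge_inf; last by exists x.
    by exists (c x i - W) => _ [y Ky <-]; rewrite lerBlDl -lerBlDr width.
  apply: lb_le_inf; first by exists (c x i), x.
  by move=> _ [y Ky <-]; rewrite lerBlDl -lerBlDr width.
(* The slack is split into n + 1 equal shares: on [K + v] each coordinate is at least [e], and the
   coordinate sum is at most [t - e]. *)
pose e := (t - n%:R * W) / n.+1%:R.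
have e0 : 0 < e by rewrite divr_gt0// subr_gt0.
pose v := (\row_i (e - m i)) *m B.
(* No [i.+1] equals 0, so index 0 gives the origin and index [i.+1] the vertex on the i-th basis
   vector. *)
pose g (k : nat) : 'rV[R]_n := t *: ((\row_i (i.+1 == k)%:R) *m B).
have g0 : g 0%N = 0.
  rewrite /g [X in X *m B](_ : _ = 0) ?mul0mx ?scaler0//.
  by apply/rowP => i; rewrite !mxE.
have gS (i : 'I_n) : g i.+1 = t *: row i B.
  rewrite /g [row i B]rowE; congr (_ *: (_ *m _)).
  by apply/rowP => j; rewrite !mxE eqxx/= eqSS.
have gM k : (k < n.+1)%N -> enorm (g k) <= t * M.
  case: k => [_|k kn]; first by rewrite g0 /enorm dotv0 sqrtr0 mulr_ge0// ltW.
  by rewrite (gS (Ordinal (kn : (k < n)%N))) enormZ gtr0_norm// ler_wpM2l// ltW.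
have cv x i : c (x + v) i = c x i - m i + e.
  rewrite /c mulmxDl /v mulmxK// !mxE; ring.
have vE x : x + v = (\row_i c (x + v) i) *m B.
  have -> : \row_i c (x + v) i = (x + v) *m invmx B by apply/rowP => i; rewrite mxE.
  by rewrite mulmxKV.
have sumc x : K x -> \sum_i c (x + v) i < t.
  move=> Kx; apply: (@le_lt_trans _ _ (\sum_(i < n) (W + e))).
    by apply: ler_sum => i _; rewrite cv lerD2r; case/andP: (cm x i Kx).
  rewrite sumr_const card_ord -mulr_natl mulrDr.
  have : n.+1%:R * e = t - n%:R * W by rewrite /e mulrC divfK.
  by rewrite -natr1 mulrDl; lra.
have posc x i : K x -> 0 < c (x + v) i.
  by move=> Kx; rewrite cv; case/andP: (cm x i Kx) => ? _; rewrite ltr_wpDl.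
exists (g @` `I_n.+1), v; split.
(* The vertices lie in [L] because [t] is the integer [f]. *)
- move=> _ [k _ <-]; rewrite LE; exists (\row_i (f * (i.+1 == k)%:R)) => //.
  rewrite /g scalemxAl; congr (_ *m _); apply/rowP => i; rewrite !mxE.
  by rewrite rmorphM /= -/t; case: eqP.
- apply: inj_card_eq => k k'; rewrite !inE /= => kn kn'.
  move=> /(scalerI (lt0r_neq0 t0)) /(congr1 (mulmx^~ (invmx B))).
  rewrite !mulmxK// => /rowP kk'.
  case: k k' => [|k] [|k'] // in kn kn' kk' *.
  + have := kk' (Ordinal (kn' : (k' < n)%N)); rewrite !mxE eqxx => /eqP.
    by rewrite eq_sym oner_eq0.
  + have := kk' (Ordinal (kn : (k < n)%N)); rewrite !mxE eqxx => /eqP.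
    by rewrite oner_eq0.
  + have := kk' (Ordinal (kn : (k < n)%N)); rewrite !mxE eqxx /=.
    by case: eqP => // _ /eqP; rewrite oner_eq0.
- move=> y /(boundary_translate _ _ _ Kc)[Kyv yb].
  have [H [[a [b [a0 HE Hy Ka]]] _]] := K_smooth _ yb.
  have {}Hy : dotv a (y - v) = b by move: Hy; rewrite HE.
  suff [k kn lt] : exists2 k, (k < n.+1)%N & dotv a y < dotv a (g k).
    exists (g k); first by exists k.
    apply: illuminates_point_translate.
    apply: (smooth_illuminated _ K_body K_smooth yb a0).
      by rewrite Hy.
    by rewrite !dotvDr ltrD2r.
  have cy : \sum_i (\row_i c (y - v + v) i) 0 i < t.
    by under eq_bigr do rewrite mxE; exact: sumc.
  have cp i : 0 < (\row_i c (y - v + v) i) 0 i by rewrite mxE posc.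
  have := simplex_vertex_beyond B t a _ Bu a0 cp cy.
  rewrite -vE subrK => -[lt|[i lt]].
    by exists 0%N => //; rewrite g0 dotv0.
  by exists i.+1; rewrite ?ltnS// gS.
(* Vertices and points of [K + v] all have norm at most [t * M], so the triangle inequality gives
   twice that. *)
- have -> : 2 * E * t * (det / lam ^+ (n - 1)) = t * M + t * M.
    by rewrite /M; ring.
  apply: ge_sup.
    exists (enorm (g 0%N - (z0 + v))), (g 0%N, z0 + v) => //.
    split; first by exists 0%N.
    by exists z0 => //; exact: interior_subset.
  move=> _ [[_ _] [/= [k kn <-] [z Kz <-]] <-].
  apply: le_trans (ler_enormD _ _) _; rewrite enormN lerD//.
    exact: gM.
  rewrite vE; apply: enorm_simplex_le => // [i|]; first by rewrite mxE ltW// posc.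
  by under eq_bigr do rewrite mxE; rewrite ltW// sumc.
Qed.
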